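(* Let $\varepsilon\in[0,1)$ and let $T,S\in\mathbb{B}_{A^{1/2}}(\mathcal{H})$ be such that $T\ge_A 0$ (i.e. $AT$ is a positive operator). Then the following assertions are equivalent: (i) $T\perp^{\varepsilon}_{\omega_A}S$; (ii) $(T+I)\perp^{\varepsilon}_{\omega_A}S$, where $I$ is the identity operator on $\mathcal{H}$.
   Context: $\mathcal{H}$ is a complex Hilbert space with inner product $\langle\cdot,\cdot\rangle$, $\mathbb{B}(\mathcal{H})$ is the algebra of bounded linear operators on $\mathcal{H}$, and $A\in\mathbb{B}(\mathcal{H})$ is a fixed non-zero positive operator ($\langle Ax,x\rangle\ge 0$ for all $x$; $A$ need not be injective). Put $\langle x,y\rangle_A=\langle Ax,y\rangle$, $\|x\|_A=\sqrt{\langle x,x\rangle_A}$ and $\mathbb{S}_{\mathcal{H}}^A=\{x\in\mathcal{H}:\|x\|_A=1\}$. $\mathbb{B}_{A^{1/2}}(\mathcal{H})$ is the set of $T\in\mathbb{B}(\mathcal{H})$ for which there is $c>0$ with $\|Tx\|_A\le c\|x\|_A$ for all $x\in\mathcal{H}$. For such $T$, the $A$-numerical radius is $\omega_A(T)=\sup\{|\langle Tx,x\rangle_A|: x\in\mathbb{S}_{\mathcal{H}}^A\}<\infty$. For $T,S\in\mathbb{B}_{A^{1/2}}(\mathcal{H})$ and $\varepsilon\in[0,1)$, $T\perp^{\varepsilon}_{\omega_A}S$ means that $\omega_A^2(T+\lambda S)\ge\omega_A^2(T)-2\varepsilon\,\omega_A(T)\,\omega_A(\lambda S)$ for all $\l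ambda\in\mathbb{C}$.
   Formalization: The hypothesis AT ≠ 0 is added: if AT = 0, assertion (i) always holds, while (ii) can fail (e.g. A = I, T = 0, S = I, taking λ = −(1−ε)), so the equivalence as printed is false in that case. *)

(* Defs.v *)
From HB Require Import structures.
From mathcomp Require Import all_boot all_order all_algebra.
From mathcomp Require Import complex.
From mathcomp Require Import all_classical all_reals all_analysis.

Set Implicit Arguments.
Unset Strict Implicit.
Unset Printing Implicit Defensive.

Import Order.TTheory GRing.Theory Num.Theory.
Import numFieldNormedType.Exports.

Local Open Scope classical_set_scope.
Local Open Scope ring_scope.
Local Open Scope complex_scope.

(* The inner product is linear in its first argument and conjugate-linear in
   its second one; the norm of H, hence its topology and its completeness,
   are the ones that it induces. *)
HB.mixin Record NormedModule_hasInner (R : realType) (H : Type)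
    & NormedModule R[i] H := {
  inner : {dot H for (@Num.conj R[i])} ;
  inner_norm : forall x : H, inner x x = `|x| ^+ 2
}.

#[short(type="hilbertType")]
HB.structure Definition Hilbert (R : realType) :=
  {H of CompleteNormedModule R[i] H & NormedModule_hasInner R H}.

Section AOperators.
Variables (R : realType) (H : hilbertType R).
Implicit Types (A T S : H -> H) (x y : H).

Definition bounded_op T := exists c : R, forall x, `|T x| <= c%:C * `|x|.

(* In the order of R[i], 0 <= z means that z is real and nonnegative. *)
Definition positive_op T := forall x, 0 <= inner (T x) x.

Definition nonzero_op T := exists x, T x != 0.

Definition innerA A x y : R[i] := inner (A x) y.

Definition seminormA A x : R := Num.sqrt (complex.Re (innerA A x x)).

Definition sphereA A : set H := [set x | seminormA A x = 1].

Definition A_bounded A T :=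
  exists2 c : R, 0 < c & forall x, seminormA A (T x) <= c * seminormA A x.

(* The norm of R[i] takes its (real) values in R[i]; Re brings them to R. *)
Definition num_radiusA A T : R :=
  sup [set complex.Re `|innerA A (T x) x| | x in sphereA A].

Definition orthA (eps : R) A T S :=
  forall lambda : R[i],
    num_radiusA A (T \+ lambda \*: S) ^+ 2
      >= num_radiusA A T ^+ 2
         - 2 * eps * num_radiusA A T * num_radiusA A (lambda \*: S).

End AOperators.

(* Main.v *)
(* Write f x = <Tx, x>_A, which is real and nonnegative, w = sup f > 0 and
   s x = <Sx, x>_A on the A-unit sphere.  Expanding |f + r c s|^2 to first order
   in r shows that T is eps-orthogonal to S if and only if, for every complex c
   and every d > 0, some x satisfies both f x > w - d and
   Re (c * s x) > - eps * w_A(c S) - d.  Replacing T by T + I turns f into f + 1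
   and w into w + 1, which leaves this condition unchanged. *)
Require Import Defs.
From mathcomp Require Import all_boot all_order all_algebra.
From mathcomp Require Import complex ring lra.
From mathcomp Require Import all_classical all_reals all_analysis.

Import Order.TTheory GRing.Theory Num.Theory.
Local Open Scope classical_set_scope.
Local Open Scope ring_scope.
Local Open Scope complex_scope.

(* Since the perturbation r * a is of first order while r ^+ 2 * b is of second
   order, letting r tend to 0 extracts the sign condition on a. *)
Lemma almost_maximizersP {R : realFieldType} {X : Type} {D : set X}
    {f a b : X -> R} {w k n m : R} :
  0 < w -> 0 <= k -> 0 <= n -> 0 <= m ->
  (forall x, D x -> 0 <= f x <= w) -> (forall x, D x -> `|a x| <= n) ->
  (forall x, D x -> 0 <= b x <= m) ->
  (forall r, 0 < r -> forall e, 0 < e -> exists2 x, D x &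
     w ^+ 2 - 2 * w * (r * k) - e < f x ^+ 2 + 2 * r * f x * a x + r ^+ 2 * b x)
  <-> (forall d, 0 < d -> exists2 x, D x & w - d < f x /\ - k - d < a x).
Proof.
move=> w0 k0 n0 m0 fw an bm; split=> [P d d0|Q r r0 e e0].
(* [K] collects every first-order term, so that the [x] found below satisfies w * (w - f x) < r * K.
   The choice of [L] gives r * K * (w + n) <= w ^+ 2 * d, and its summand w ^+ 2 * d keeps r <=
   1. *)
- pose K := 2 * w * (k + n) + 1 + m; pose L := K * (w + n) + w ^+ 2 * d.
  have K0 : 0 < K by rewrite /K; nra.
  have L0 : 0 < L by rewrite /L; nra.
  pose r := w ^+ 2 * d / L.
  have r0 : 0 < r by rewrite /r divr_gt0 // mulr_gt0 ?exprn_gt0.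
  have rL : r * L = w ^+ 2 * d by rewrite /r divfK ?gt_eqF.
  have r1 : r <= 1.
    by rewrite /r ler_pdivrMr // mul1r /L lerDr ltW // mulr_gt0 // ltr_pwDl.
  have rK : r * (K * (w + n)) <= w ^+ 2 * d.
    by rewrite -rL ler_pM2l // /L lerDl; nra.
  (* The slack r ^+ 2 is of second order, so it still tends to 0 with r after division by r. *)
  have [x Dx Px] := P r r0 (r ^+ 2) (exprn_gt0 2 r0); exists x => //.
  have /andP[f0 fw'] := fw x Dx; have /andP[b0 bm'] := bm x Dx.
  have /ler_normlP[an1 an2] := an x Dx.
  move: (f x) (a x) (b x) f0 fw' b0 bm' an1 an2 Px
    => {fw an bm P} F A B F0 Fw B0 Bm An1 An2 Px.
  have rrB : r ^+ 2 * B <= r ^+ 2 * m by rewrite ler_wpM2l // exprn_ge0 // ltW.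
  have rr : r ^+ 2 * (1 + m) <= r * (1 + m).
    by rewrite ler_wpM2r ?addr_ge0 // expr2 ler_piMl // ltW.
  have FA : F * A <= w * n.
    by apply: le_trans (ler_wpM2r n0 Fw); rewrite ler_wpM2l.
  have rFA : r * (F * A) <= r * (w * n) by rewrite ler_pM2l.
  have wF : w * (w - F) < r * K.
    have : w * (w - F) <= w ^+ 2 - F ^+ 2 by nra.
    rewrite /K; nra.
  (* As F ^+ 2 <= w ^+ 2, the squares drop out of [Px]; what remains is divided by r. *)
  have FAgt : - (2 * w * k) - r * (1 + m) < 2 * (F * A).
    rewrite -(ltr_pM2l r0); nra.
  (* Replacing F by w in F * A costs at most (w - F) * n, which [wF] makes small. *)
  have wFA : (w - F) * - A <= (w - F) * n by rewrite ler_wpM2l ?subr_ge0.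
  have wAlt : 2 * w * (- k - A) < r * K + 2 * (w - F) * n.
    have : r * (1 + m) <= r * K by rewrite ler_pM2l // /K; nra.
    nra.
  have wFn : w * (w - F) * n <= r * K * n by rewrite ler_wpM2r // ltW.
  have rKn : 0 <= r * K * n by rewrite mulr_ge0 // ltW // mulr_gt0.
  have rKw : 0 <= r * K * w by rewrite mulr_ge0 // ltW // mulr_gt0.
  have w20 : 0 < w ^+ 2 by rewrite exprn_gt0.
  split.
    rewrite ltrBlDr -ltrBlDl -(ltr_pM2l w20) (lt_le_trans _ rK) //.
    move: wF; rewrite -(ltr_pM2l w0); lra.
  rewrite ltrBlDr -ltrBlDl -(ltr_pM2l w20).
  rewrite -(ltr_pM2l w0) in wAlt; lra.
(* The losses in F ^+ 2 and in 2 * r * F * A add up to 2 * w * (1 + r) * d; this [M] keeps them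
   below e, and its summand e gives d <= w. *)
pose M := 2 * w ^+ 2 * (1 + r) + e.
have M0 : 0 < M by rewrite /M; nra.
pose d := e * w / M.
have d0 : 0 < d by rewrite /d divr_gt0 // mulr_gt0.
have dM : d * M = e * w by rewrite /d divfK ?gt_eqF.
have dw : d <= w.
  rewrite /d ler_pdivrMr // mulrC ler_pM2l // /M lerDr mulr_ge0 //; nra.
have de : 2 * w * (1 + r) * d < e.
  rewrite -(ltr_pM2r w0) -dM /M; nra.
have [x Dx [Fd Ak]] := Q d d0; exists x => //.
have /andP[f0 fw'] := fw x Dx; have /andP[b0 _] := bm x Dx.
move: (f x) (a x) (b x) f0 fw' b0 Fd Ak
    => {fw an bm Q} F A B F0 Fw B0 Fd Ak.
have rrB : 0 <= r ^+ 2 * B by rewrite mulr_ge0 // exprn_ge0 // ltW.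
have F2 : w ^+ 2 - 2 * w * d <= F ^+ 2 by nra.
have FA : - (w * (k + d)) <= F * A by nra.
have rFA : - (r * (w * (k + d))) <= r * (F * A) by rewrite -mulrN ler_pM2l.
nra.
Qed.

(** Squaring is increasing on nonnegative values, so it commutes with the supremum. This trades a
    bound on a squared numerical radius for single vectors, although the supremum may not be
    attained. *)
Lemma le_sqr_supP {R : realType} {X : Type} {D : set X} {g : X -> R} {c : R} :
  D !=set0 -> has_ubound (g @` D) -> (forall x, D x -> 0 <= g x) ->
  c <= sup (g @` D) ^+ 2 <->
  forall e, 0 < e -> exists2 x, D x & c - e < g x ^+ 2.
Proof.
move=> [x0 Dx0] gub g0; have g_le x : D x -> g x <= sup (g @` D).
  by move=> Dx; apply: ub_le_sup => //; exists x.
have sup0 : 0 <= sup (g @` D) by apply: le_trans (g_le _ Dx0); exact: g0.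
split=> [csup e e0|P].
- apply: contrapT => /forall2NP gle.
  have {}gle x : D x -> g x ^+ 2 <= c - e.
    by move=> Dx; have [//|/negP] := gle x; rewrite -leNgt.
  (* [Num.sqrt] is 0 on negative numbers, so this sign is what allows c - e to be recovered from its
     root. *)
  have ce0 : 0 <= c - e by apply: le_trans (gle _ Dx0); exact: sqr_ge0.
  have : sup (g @` D) <= Num.sqrt (c - e).
    apply: ge_sup; first by exists (g x0), x0.
    move=> _ [x Dx <-]; rewrite -(ger0_norm (g0 x Dx)) -sqrtr_sqr.
    by rewrite ler_wsqrtr ?gle.
  rewrite -(@ler_pXn2r _ 2) ?nnegrE ?sqrtr_ge0 // sqr_sqrtr //; lra.
rewrite leNgt; apply/negP => supc.
have [|x Dx] := P (c - sup (g @` D) ^+ 2); first by rewrite subr_gt0.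
by rewrite subKr ltNge ler_pXn2r ?nnegrE ?g0 // g_le.
Qed.

Lemma sup_shift {R : realType} {X : Type} {D : set X} {g : X -> R} (c : R) :
  D !=set0 -> has_ubound (g @` D) ->
  sup [set g x + c | x in D] = sup (g @` D) + c.
Proof.
move=> [x0 Dx0] gub.
have g_le x : D x -> g x <= sup (g @` D).
  by move=> Dx; apply: ub_le_sup => //; exists x.
have gc_ub : ubound [set g x + c | x in D] (sup (g @` D) + c).
  by move=> _ [x Dx <-]; rewrite lerD2r g_le.
apply/eqP; rewrite eq_le ge_sup //=; last by exists (g x0 + c), x0.
rewrite -lerBrDr; apply: ge_sup; first by exists (g x0), x0.
move=> _ [x Dx <-]; rewrite lerBrDr; apply: ub_le_sup; last by exists x.
by exists (sup (g @` D) + c).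
Qed.

Lemma sup_scale {R : realType} {X : Type} {D : set X} {g : X -> R} {c : R} :
  0 < c -> D !=set0 -> has_ubound (g @` D) ->
  sup [set c * g x | x in D] = c * sup (g @` D).
Proof.
move=> c0 [x0 Dx0] gub.
have g_le x : D x -> g x <= sup (g @` D).
  by move=> Dx; apply: ub_le_sup => //; exists x.
have gc_ub : ubound [set c * g x | x in D] (c * sup (g @` D)).
  by move=> _ [x Dx <-]; rewrite ler_pM2l // g_le.
apply/eqP; rewrite eq_le ge_sup //=; last by exists (c * g x0), x0.
rewrite -ler_pdivlMl //; apply: ge_sup; first by exists (g x0), x0.
move=> _ [x Dx <-]; rewrite ler_pdivlMl //; apply: ub_le_sup; last by exists x.
by exists (c * sup (g @` D)).
Qed.

(** * Modulus and real part of complex numbers *)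

Lemma Re_norm_ge0 {R : rcfType} (z : R[i]) : 0 <= complex.Re `|z|.
Proof. by case: z => x y; exact: sqrtr_ge0. Qed.

Lemma sqr_Re_norm {R : rcfType} (z : R[i]) :
  complex.Re `|z| ^+ 2 = complex.Re z ^+ 2 + complex.Im z ^+ 2.
Proof. by case: z => x y /=; rewrite sqr_sqrtr // addr_ge0 ?sqr_ge0. Qed.

Lemma Re_norm_real {R : rcfType} (x : R) : 0 <= x -> complex.Re `|x%:C| = x.
Proof. by move=> x0 /=; rewrite expr0n addr0 sqrtr_sqr ger0_norm. Qed.

Lemma Re_normM {R : rcfType} (y z : R[i]) :
  complex.Re `|y * z| = complex.Re `|y| * complex.Re `|z|.
Proof. exact: Normc.normcM. Qed.

Lemma norm_Re_le {R : rcfType} (z : R[i]) : `|complex.Re z| <= complex.Re `|z|.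
Proof. by have := normc_ge_Re z; rewrite -lecR. Qed.

(** * Positive operators on a complex Hilbert space *)

Section InnerProduct.
Context {R : realType} {H : hilbertType R}.

Lemma inner_scalel c (x y : H) : inner (c *: x) y = c * inner x y.
Proof. exact: linearZl_LR. Qed.

Lemma inner_scaler c (x y : H) : inner x (c *: y) = Num.conj c * inner x y.
Proof. exact: linearZr_LR. Qed.

(* Polarization: 4 <By, x> is the sum of i^k <B(y + i^k x), y + i^k x> over
   k < 4, whose terms <B(y + i^k x), y + i^k x> are nonnegative. *)
Lemma positive_op_bound {B : {linear H -> H}} : positive_op B -> forall x y,
  complex.Re `|inner (B y) x| <=
    complex.Re (inner (B x) x) + complex.Re (inner (B y) y).
Proof.
move=> Bpos x y; pose Q (c : R[i]) := inner (B (y + c *: x)) (y + c *: x).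
have Q0 c : 0 <= Q c := Bpos _.
have QE c : Q c = inner (B y) y + c * Num.conj c * inner (B x) x +
    (Num.conj c * inner (B y) x + c * inner (B x) y).
  rewrite /Q linearD linearZ linearDl !linearDr /=.
  rewrite !(inner_scalel, inner_scaler); ring.
have conjN1 : Num.conj (- 1) = - 1 :> R[i] by rewrite rmorphN rmorph1.
have conjNi : Num.conj (- 'i%R) = 'i%R :> R[i].
  by rewrite rmorphN /= conjCi opprK.
have polar : 4 * inner (B y) x = Q 1 - Q (- 1) + 'i%R * (Q 'i%R - Q (- 'i%R)).
  rewrite !QE conjC1 conjN1 conjCi conjNi.
  have := sqrCi R[i]; rewrite expr2; set j := 'i%R => jj.
  ring: jj.
have sumQ : Q 1 + Q (- 1) + (Q 'i%R + Q (- 'i%R)) =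
    4 * (inner (B x) x + inner (B y) y).
  rewrite !QE conjC1 conjN1 conjCi conjNi.
  have := sqrCi R[i]; rewrite expr2; set j := 'i%R => jj.
  ring: jj.
(* The coefficients in [polar] have modulus 1 and each [Q c] equals its own modulus, so the triangle
   inequality leads to the left side of [sumQ]. *)
have : 4 * `|inner (B y) x| <= 4 * (inner (B x) x + inner (B y) y).
  rewrite -[X in X * `|_|]ger0_norm ?ler0n // -normrM polar -sumQ.
  rewrite (le_trans (ler_normD _ _)) // normrM normCi mul1r.
  by rewrite lerD // (le_trans (ler_normB _ _)) // !ger0_norm.
rewrite ler_pM2l ?ltr0n // lecE => /andP[_].
by case: (inner (B x) x) => ? ?; case: (inner (B y) y).
Qed.

(** In [positive_op_bound], pair B x with t * x: the left side grows linearly in t, while the right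
    side stays constant because <Bx, x> = 0. Hence <Bx, Bx> = 0. *)
Lemma positive_op_eq0 {B : {linear H -> H}} : positive_op B ->
  forall x, inner (B x) x = 0 -> B x = 0.
Proof.
move=> Bpos x Bx0; apply/eqP; rewrite -normr_eq0 -sqrf_eq0 -inner_norm.
set q := complex.Re (inner (B (B x)) (B x)).
set N := complex.Re `|inner (B x) (B x)|.
have tN (t : R) : 0 < t -> t * N <= q.
  move=> t0; have := positive_op_bound Bpos (B x) (t%:C *: x).
  have -> : B (t%:C *: x) = t%:C *: B x by rewrite linearZ.
  rewrite !(inner_scalel, inner_scaler) Bx0 !mulr0 addr0.
  by rewrite Re_normM Re_norm_real // ltW.
have q0 : 0 <= q by have := Bpos (B x); rewrite lecE => /andP[].
rewrite -normr_eq0 -[`|_|]RRe_real ?normr_real // -/N.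
have : 0 <= N := Re_norm_ge0 _.
rewrite le_eqVlt => /orP[/eqP <- //|N0].
(* This t would give q + 1 <= q. *)
have := tN ((q + 1) / N) (divr_gt0 (ltr_wpDl q0 ltr01) N0).
by rewrite divfK ?lt0r_neq0 // gerDl ler10.
Qed.

End InnerProduct.

(** Finiteness is tracked separately, since [sup] takes a default value on unbounded sets. *)
Definition has_num_radiusA {R : realType} {H : hilbertType R} (A T : H -> H) :=
  has_ubound [set complex.Re `|innerA A (T x) x| | x in sphereA A].

(** * The A-numerical radius and orthogonality through almost maximizers *)

Section NumericalRadius.
Context {R : realType} {H : hilbertType R} {A : {linear H -> H}}.
Implicit Types T S : H -> H.

Lemma innerA_addl x y z : innerA A (x + y) z = innerA A x z + innerA A y z.
Proof. by rewrite /innerA linearD linearDl. Qed.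

Lemma innerA_scalel c x z : innerA A (c *: x) z = c * innerA A x z.
Proof. by rewrite /innerA linearZ linearZl_LR. Qed.

Lemma num_radiusA_real {T} {f : H -> R} :
  (forall x, sphereA A x -> innerA A (T x) x = (f x)%:C) ->
  (forall x, sphereA A x -> 0 <= f x) ->
  num_radiusA A T = sup (f @` sphereA A).
Proof.
move=> Tf f0; congr sup; apply: eq_imagel => x Dx.
by rewrite Tf // Re_norm_real ?f0.
Qed.

Lemma num_radiusA_ub {T} : has_num_radiusA A T ->
  forall x, sphereA A x -> complex.Re `|innerA A (T x) x| <= num_radiusA A T.
Proof. by move=> Tub x Dx; apply: ub_le_sup => //; exists x. Qed.

Lemma has_num_radiusAZ {S} (c : R[i]) :
  has_num_radiusA A S -> has_num_radiusA A (c \*: S).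
Proof.
move=> Sub; exists (complex.Re `|c| * num_radiusA A S) => _ [x Dx <-].
rewrite innerA_scalel Re_normM ler_wpM2l ?Re_norm_ge0 //.
exact: num_radiusA_ub.
Qed.

Lemma num_radiusAZ {S} (r : R) (c : R[i]) : 0 < r -> sphereA A !=set0 ->
  has_num_radiusA A S ->
  num_radiusA A ((r%:C * c) \*: S) = r * num_radiusA A (c \*: S).
Proof.
move=> r0 D0 Sub; rewrite -sup_scale //; last exact: has_num_radiusAZ.
congr sup; apply: eq_imagel => x Dx.
by rewrite !innerA_scalel -mulrA Re_normM Re_norm_real // ltW.
Qed.

(** For each direction c, [almost_maximizersP] applies with n = w_A(c S), k = eps * n and m = n ^+
    2. Keeping [f] abstract lets the lemma serve both T and T + I. *)
Lemma orthA_almost_maximizersP {eps : R} {T S} {f : H -> R} : 0 <= eps ->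
  sphereA A !=set0 ->
  (forall x, sphereA A x -> innerA A (T x) x = (f x)%:C) ->
  (forall x, sphereA A x -> 0 <= f x) ->
  has_ubound (f @` sphereA A) -> 0 < sup (f @` sphereA A) ->
  has_num_radiusA A S ->
  orthA eps A T S <->
  forall (c : R[i]) (d : R), 0 < d -> exists2 x, sphereA A x &
    sup (f @` sphereA A) - d < f x /\
    - (eps * num_radiusA A (c \*: S)) - d < complex.Re (c * innerA A (S x) x).
Proof.
move=> eps0 D0 Tf f0 fub w0 Sub; set w := sup _ in w0 *.
have N_ub c x : sphereA A x ->
    complex.Re `|c * innerA A (S x) x| <= num_radiusA A (c \*: S).
  move=> Dx; rewrite -innerA_scalel.
  exact: (num_radiusA_ub (has_num_radiusAZ c Sub)).
have N0 c : 0 <= num_radiusA A (c \*: S).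
  by case: D0 => x Dx; apply: le_trans (N_ub c x Dx); exact: Re_norm_ge0.
have sqr_sum c x : sphereA A x ->
    complex.Re `|innerA A ((T \+ c \*: S) x) x| ^+ 2 =
    f x ^+ 2 + 2 * f x * complex.Re (c * innerA A (S x) x) +
    complex.Re `|c * innerA A (S x) x| ^+ 2.
  move=> Dx; rewrite innerA_addl innerA_scalel Tf // !sqr_Re_norm.
  case: (c * _) => u v /=; ring.
have orthAE : orthA eps A T S <-> forall c e, 0 < e -> exists2 x, sphereA A x &
    w ^+ 2 - 2 * w * (eps * num_radiusA A (c \*: S)) - e <
    f x ^+ 2 + 2 * f x * complex.Re (c * innerA A (S x) x) +
    complex.Re `|c * innerA A (S x) x| ^+ 2.
  have TSub c : has_num_radiusA A (T \+ c \*: S).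
    exists (w + num_radiusA A (c \*: S)) => _ [x Dx <-].
    rewrite innerA_addl innerA_scalel Tf //.
    rewrite (le_trans (le_normcD _ _)) // lerD //; last exact: N_ub.
    by rewrite [leLHS]Re_norm_real ?f0 //; apply: ub_le_sup => //; exists x.
  split=> [P c|P c].
    have := P c; rewrite (num_radiusA_real Tf f0) => /(le_sqr_supP D0 (TSub c)).
    move=> Q e e0; have [x Dx Px] := Q (fun _ _ => Re_norm_ge0 _) e e0.
    exists x => //; rewrite -sqr_sum //; move: Px; rewrite -/w; lra.
  rewrite (num_radiusA_real Tf f0) -/w.
  apply/(le_sqr_supP D0 (TSub c) (fun _ _ => Re_norm_ge0 _)) => e e0.
  have [x Dx Px] := P c e e0.
  exists x => //; rewrite sqr_sum //; move: Px; lra.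
have fw x : sphereA A x -> 0 <= f x <= w.
  by move=> Dx; rewrite f0 //=; apply: ub_le_sup => //; exists x.
have an c x : sphereA A x ->
    `|complex.Re (c * innerA A (S x) x)| <= num_radiusA A (c \*: S).
  by move=> Dx; apply: le_trans (norm_Re_le _) _; exact: N_ub.
have bm c x : sphereA A x ->
    0 <= complex.Re `|c * innerA A (S x) x| ^+ 2
      <= num_radiusA A (c \*: S) ^+ 2.
  by move=> Dx; rewrite sqr_ge0 ler_pXn2r ?nnegrE ?Re_norm_ge0 ?N_ub.
have maxP c := almost_maximizersP w0 (mulr_ge0 eps0 (N0 c)) (N0 c)
  (sqr_ge0 (num_radiusA A (c \*: S))) fw (an c) (bm c).
rewrite orthAE; split=> [P c|Q c].
  (* Orthogonality is tested at lambda = r * c; homogeneity of the radius and of the form brings out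
     the powers of r. *)
  apply/maxP => r r0 e e0; have [x Dx Px] := P (r%:C * c) e e0.
  exists x => //; move: Px.
  rewrite num_radiusAZ // -[_ * c * _]mulrA Re_normM Re_norm_real ?(ltW r0) //.
  rewrite exprMn.
  have -> : complex.Re (r%:C * (c * innerA A (S x) x)) =
      r * complex.Re (c * innerA A (S x) x).
    by case: (c * _) => u v /=; rewrite mul0r subr0.
  lra.
(* Since c is arbitrary, r = 1 already covers every lambda. *)
move=> e e0; have [x Dx Px] := (iffRL (maxP c) (Q c)) 1 ltr01 e e0.
by exists x => //; move: Px; rewrite mul1r mulr1 expr1n mul1r.
Qed.

(** * The A-seminorm; finiteness and positivity of the A-numerical radius *)

Lemma seminormA_sqr : positive_op A -> forall x,
  (seminormA A x ^+ 2)%:C = innerA A x x.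
Proof.
move=> Apos x; have Ax0 : 0 <= innerA A x x := Apos x.
rewrite sqr_sqrtr; first by rewrite RRe_real // ger0_real.
by move: Ax0; rewrite lecE => /andP[].
Qed.

Lemma seminormA_eq0 : positive_op A -> forall x,
  seminormA A x = 0 -> A x = 0.
Proof.
move=> Apos x sx0; apply: positive_op_eq0 => //.
by rewrite -[LHS]/(innerA A x x) -seminormA_sqr // sx0 expr0n.
Qed.

Lemma seminormA_gt0 : positive_op A -> forall x,
  A x != 0 -> 0 < seminormA A x.
Proof.
move=> Apos x Ax0; rewrite lt_neqAle sqrtr_ge0 andbT eq_sym.
by apply: contra Ax0 => /eqP /(seminormA_eq0 Apos) ->.
Qed.

Lemma sphereA_normalize : positive_op A -> forall x,
  0 < seminormA A x -> sphereA A ((seminormA A x)^-1%:C *: x).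
Proof.
move=> Apos x; set s := seminormA A x => s0.
rewrite /sphereA /= /seminormA innerA_scalel /innerA inner_scaler.
rewrite -[inner _ _]/(innerA A x x) -seminormA_sqr // -/s.
rewrite [Num.conj _]conjc_real -!rmorphM /=.
by rewrite expr2 mulKf ?gt_eqF // mulVf ?gt_eqF // sqrtr1.
Qed.

(** On the A-unit sphere, [positive_op_bound] at T x and x bounds the form by 1 + c ^+ 2, a crude
    constant that suffices for finiteness. *)
Lemma A_bounded_has_num_radiusA {T} :
  positive_op A -> A_bounded A T -> has_num_radiusA A T.
Proof.
move=> Apos [c c0 Tc]; exists (1 + c ^+ 2) => _ [x Dx <-].
apply: le_trans (positive_op_bound Apos _ _) _.
rewrite -2![inner (A _) _]/(innerA A _ _) -!seminormA_sqr //= Dx expr1n.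
rewrite lerD2l ler_pXn2r ?nnegrE ?sqrtr_ge0 ?(ltW c0) //.
by have := Tc x; rewrite Dx mulr1.
Qed.

(** Normalize some x with A (T x) != 0. Were the form of A T zero there, it would vanish at x by
    homogeneity, and positivity of A T would force A (T x) = 0. *)
Lemma num_radiusA_gt0 {T : {linear H -> H}} :
  positive_op A -> A_bounded A T -> positive_op (A \o T) ->
  nonzero_op (A \o T) -> 0 < num_radiusA A T.
Proof.
move=> Apos Tbd ATpos [x ATx].
have s0 : 0 < seminormA A x.
  rewrite lt_neqAle sqrtr_ge0 andbT eq_sym.
  (* A-boundedness makes T preserve the kernel of the seminorm, which lies in the kernel of A. *)
  apply: contra ATx => /eqP sx0; apply/eqP/(seminormA_eq0 Apos).
  case: Tbd => c c0 /(_ x); rewrite sx0 mulr0 => sTx.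
  by apply/eqP; rewrite eq_le sTx sqrtr_ge0.
have := num_radiusA_ub (A_bounded_has_num_radiusA Apos Tbd)
  _ (sphereA_normalize Apos _ s0).
apply: lt_le_trans; rewrite lt_neqAle Re_norm_ge0 andbT eq_sym.
apply: contra ATx => /eqP /Normc.eq0_normc /eqP.
rewrite linearZ innerA_scalel /innerA inner_scaler !mulf_eq0 conjC_eq0.
rewrite eq_complex /= eqxx andbT invr_eq0 gt_eqF //= => /eqP ATx0.
by apply/eqP; apply: (positive_op_eq0 ATpos).
Qed.

End NumericalRadius.

(* The hypothesis nonzero_op (A \o T) excludes AT = 0: in that case the first
   assertion always holds, while the second one fails for S = I. *)
Theorem theorem3p2 (R : realType) (H : hilbertType R)
    (A : {linear H -> H}) (A_bdd : bounded_op A) (A_pos : positive_op A)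
    (A_neq0 : nonzero_op A)
    (eps : R) (eps01 : 0 <= eps < 1)
    (T S : {linear H -> H})
    (T_bdd : bounded_op T) (T_Abdd : A_bounded A T)
    (S_bdd : bounded_op S) (S_Abdd : A_bounded A S)
    (T_Apos : positive_op (A \o T)) (AT_neq0 : nonzero_op (A \o T)) :
  orthA eps A T S <-> orthA eps A (T \+ idfun) S.
Proof.
have eps0 : 0 <= eps by case/andP: eps01.
have D0 : sphereA A !=set0.
  have [x Ax] := A_neq0; eexists.
  exact: (sphereA_normalize A_pos x (seminormA_gt0 A_pos x Ax)).
have Sub : has_num_radiusA A S := A_bounded_has_num_radiusA A_pos S_Abdd.
pose f x := complex.Re (innerA A (T x) x).
have Tf x : sphereA A x -> innerA A (T x) x = (f x)%:C.
  by move=> _; rewrite /f RRe_real // ger0_real // T_Apos.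
have f0 x : sphereA A x -> 0 <= f x.
  by move=> _; have := T_Apos x; rewrite lecE => /andP[].
have w0 : 0 < sup (f @` sphereA A).
  by rewrite -(num_radiusA_real Tf f0); exact: num_radiusA_gt0.
have fub : has_ubound (f @` sphereA A).
  exists (num_radiusA A T) => _ [x Dx <-].
  rewrite -(Re_norm_real _ (f0 x Dx)) -Tf //.
  exact: (num_radiusA_ub (A_bounded_has_num_radiusA A_pos T_Abdd)).
have T1f x : sphereA A x -> innerA A ((T \+ idfun) x) x = (f x + 1)%:C.
  (* On the A-unit sphere the identity contributes <x, x>_A = 1. *)
  by move=> Dx; rewrite innerA_addl Tf // -seminormA_sqr // Dx expr1n rmorphD.
have f10 x : sphereA A x -> 0 <= f x + 1 by move=> Dx; rewrite addr_ge0 ?f0.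
have f1ub : has_ubound [set f x + 1 | x in sphereA A].
  case: fub => M fM; exists (M + 1) => _ [x Dx <-].
  by rewrite lerD2r; apply: fM; exists x.
have w1 : 0 < sup [set f x + 1 | x in sphereA A].
  by rewrite sup_shift // ltr_wpDr.
rewrite (orthA_almost_maximizersP eps0 D0 Tf f0 fub w0 Sub).
rewrite (orthA_almost_maximizersP eps0 D0 T1f f10 f1ub w1 Sub) sup_shift //.
(* The two conditions differ only by 1 on both sides of the first inequality, so the same x serves
   for both. *)
split=> P c d d0; have [x Dx [fx cx]] := P c d d0; exists x => //; split=> //.
  by rewrite addrAC ltrD2r.
by rewrite addrAC ltrD2r in fx.
Qed.
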